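(* Let $f,g:\mathbb{R}^n\to\mathbb{R}$ be twice continuously differentiable, with $\lim_{|x|\to\infty}f(x)=+\infty$, and suppose $\nabla g(x)\neq 0$ for all $x\in\mathbb{R}^n$. Let $\zeta\in[0,1)$ and $x_0\in\{x:g(x)\le 0\}$. Then the trajectory $x(t;\zeta,x_0)$ converges to a connected subset of critical points of $f$. In particular, if the critical points of $f$ are isolated, then $\lim_{t\to T_{\zeta,x_0}^-}x(t;\zeta,x_0)=x_c$ for some critical point $x_c$ of $f$.
   Context: For $\zeta\in[0,1)$, $\mathbf{s}_\zeta(x)=-\frac{\nabla f(x)}{|\nabla f(x)|}-\zeta\frac{\nabla g(x)}{|\nabla g(x)|}$ ($|\cdot|$ Euclidean norm), defined on $E=\{x:\nabla f(x)\neq0,\ \nabla g(x)\neq 0\}$. The trajectory $x(t;\zeta,x_0)$ is the solution of $\frac{dx}{dt}=\mathbf{s}_\zeta(x)$, $x(0)=x_0$, and $[0,T_{\zeta,x_0})$ is its maximal interval of existence in $E$. *)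

(* Defs.v *)
From HB Require Import structures.
From mathcomp Require Import all_boot all_order all_algebra.
From mathcomp Require Import all_classical all_reals all_analysis.
Set Implicit Arguments. Unset Strict Implicit. Unset Printing Implicit Defensive.
Import Order.TTheory GRing.Theory Num.Theory.
Import numFieldNormedType.Exports.
Local Open Scope classical_set_scope.
Local Open Scope ring_scope.

Section Defs.
Variables (R : realType) (n : nat).
Notation V := 'rV[R]_n.

(* Euclidean norm on R^n (the ambient norm of 'rV is the sup norm) *)
Definition eucl (v : V) : R := Num.sqrt (\sum_(i < n) v ord0 i ^+ 2).

Definition ebasis (i : 'I_n) : V := delta_mx ord0 i.
Definition partial (i : 'I_n) (f : V -> R) (x : V) : R := 'D_(ebasis i) f x.

Definition grad (f : V -> R) (x : V) : V := \row_i partial i f x.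

Definition C2 (f : V -> R) : Prop :=
  forall i : 'I_n,
    (forall x, derivable f x (ebasis i)) /\ continuous (partial i f) /\
    forall j : 'I_n,
      (forall x, derivable (partial i f) x (ebasis j)) /\
      continuous (partial j (partial i f)).

Definition coercive (f : V -> R) : Prop :=
  forall M : R, exists r : R, forall x, r < eucl x -> M < f x.

Definition domE (f g : V -> R) : set V :=
  [set x | grad f x != 0 /\ grad g x != 0].

Definition sfield (f g : V -> R) (z : R) (x : V) : V :=
  - ((eucl (grad f x))^-1 *: grad f x) - (z * (eucl (grad g x))^-1) *: grad g x.

Definition is_sol (f g : V -> R) (z : R) (x0 : V) (T : \bar R) (y : R -> V) : Prop :=
  (0 < T)%E /\
  y 0 = x0 /\
  (y t @[t --> 0^'+] --> x0) /\
  (forall t : R, 0 <= t -> (t%:E < T)%E -> domE f g (y t)) /\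
  (forall t : R, 0 < t -> (t%:E < T)%E -> is_derive t (1 : R) y (sfield f g z (y t))).

Definition is_max_traj (f g : V -> R) (z : R) (x0 : V) (T : \bar R) (y : R -> V) : Prop :=
  is_sol f g z x0 T y /\
  forall (T' : \bar R) (y' : R -> V), (T < T')%E -> ~ is_sol f g z x0 T' y'.

Definition limit_set (T : \bar R) (y : R -> V) : set V :=
  [set p | forall e : R, 0 < e -> forall t0 : R, (t0%:E < T)%E ->
     exists t : R, t0 < t /\ (t%:E < T)%E /\ eucl (y t - p) < e].

Definition critical (f : V -> R) : set V := [set x | grad f x = 0].

Definition isolated_critical (f : V -> R) : Prop :=
  forall c, critical f c -> exists r : R, 0 < r /\
    forall x, critical f x -> eucl (x - c) < r -> x = c.

End Defs.

(* Main.v *)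
(* Write s for the field. Since the two normalized gradients have inner product
   at least -1, f decreases along x at rate at least (1 - zeta)|grad f|, so by
   coercivity x stays in a compact set, and |x'| <= 2. The limit set is the
   set of cluster points of x at the left end T^-; by compactness it is nonempty,
   attracts x, and is connected (images of intervals are connected).
   If T is infinite and p is a limit point with grad f(p) <> 0, every visit of x
   near p lasts long enough for f to drop by a fixed amount, below f(p), which is
   impossible. If T is finite, x is Lipschitz and converges to p at T; if
   grad f(p) <> 0 then s is locally Lipschitz at p, and a local solution through
   p (Picard iteration) prolongs x beyond T, against maximality. *)
Require Import Defs.
From HB Require Import structures.
From mathcomp Require Import all_boot all_order all_algebra.
From mathcomp Require Import all_classical all_reals all_analysis.
From mathcomp Require Import ring lra.
Import Order.TTheory GRing.Theory Num.Theory.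
Import numFieldNormedType.Exports.
Local Open Scope classical_set_scope.
Local Open Scope ring_scope.
Set Implicit Arguments.
Unset Strict Implicit.
Unset Printing Implicit Defensive.

(** * Euclidean norm and the mean value inequality *)

Lemma ler_coord_norm (R : realType) n (v : 'rV[R]_n) i : `|v ord0 i| <= `|v|.
Proof.
rewrite [leRHS]/Num.Def.normr /= mx_normrE.
by apply: (le_bigmax _ (fun ij => `|v ij.1 ij.2|) (ord0, i)).
Qed.

Lemma rV_norm_le (R : realType) n (v : 'rV[R]_n) (c : R) :
  0 <= c -> (forall i, `|v ord0 i| <= c) -> `|v| <= c.
Proof.
move=> c0 vc; rewrite [leLHS]/Num.Def.normr /= mx_normrE.
by apply: bigmax_le => // -[i j] _ /=; rewrite (ord1 i).
Qed.

Lemma eucl_le_norm (R : realType) n (v : 'rV[R]_n) : eucl v <= n%:R * `|v|.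
Proof.
rewrite /eucl -(@ger0_norm _ (n%:R * `|v|)) ?mulr_ge0// -sqrtr_sqr.
rewrite ler_wsqrtr// exprMn.
apply: (@le_trans _ _ (n%:R * `|v| ^+ 2)).
  have -> : n%:R * `|v| ^+ 2 = \sum_(i < n) `|v| ^+ 2.
    by rewrite sumr_const card_ord mulr_natl.
  apply: ler_sum => i _.
  by rewrite -[leLHS]real_normK ?num_real// ler_pXn2r ?nnegrE// ler_coord_norm.
rewrite ler_wpM2r ?sqr_ge0//.
by rewrite -natrX ler_nat; move: (n) => [//|m]; rewrite leq_pmulr.
Qed.

(** The divisor [n.+1] instead of [n] stays nonzero in dimension 0, so sup-norm estimates become
    Euclidean ones without a case distinction. *)
Lemma eucl_lt (R : realType) n (v : 'rV[R]_n) (e : R) :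
  `|v| < e / n.+1%:R -> eucl v < e.
Proof.
rewrite ltr_pdivlMr// mulrC => ve; apply: le_lt_trans ve.
by apply: le_trans (eucl_le_norm _) _; rewrite ler_wpM2r// ler_nat.
Qed.

Lemma ler_norm_eucl (R : realType) n (v : 'rV[R]_n) : `|v| <= eucl v.
Proof.
apply: rV_norm_le => [|i]; first exact: sqrtr_ge0.
rewrite -sqrtr_sqr ler_wsqrtr// (bigD1 i)//= lerDl.
by apply: sumr_ge0 => j _; exact: sqr_ge0.
Qed.

Lemma eucl_eq0 (R : realType) n (v : 'rV[R]_n) : (eucl v == 0) = (v == 0).
Proof.
apply/eqP/eqP => [v0|->].
  by apply/eqP; rewrite -normr_le0 -v0 ler_norm_eucl.
by rewrite /eucl big1 ?sqrtr0// => i _; rewrite mxE expr0n.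
Qed.

Lemma eucl_gt0 (R : realType) n (v : 'rV[R]_n) : v != 0 -> 0 < eucl v.
Proof. by rewrite -eucl_eq0 => v0; rewrite lt_def v0 sqrtr_ge0. Qed.

Lemma sqr_eucl (R : realType) n (v : 'rV[R]_n) :
  eucl v ^+ 2 = \sum_(i < n) v ord0 i ^+ 2.
Proof. by rewrite sqr_sqrtr// sumr_ge0// => i _; exact: sqr_ge0. Qed.

(** Expand [0 <= |u + w|^2]. *)
Lemma dot_unit_geN1 (R : realType) n (u w : 'rV[R]_n) :
  eucl u = 1 -> eucl w = 1 -> - 1 <= \sum_(i < n) u ord0 i * w ord0 i.
Proof.
move=> u1 w1.
have : 0 <= \sum_(i < n) (u ord0 i + w ord0 i) ^+ 2.
  by apply: sumr_ge0 => i _; exact: sqr_ge0.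
under eq_bigr do rewrite sqrrD.
rewrite 2!big_split /= -!sqr_eucl u1 w1 sumrMnl; lra.
Qed.

(** The slope [l] is a reference: [l = 0] gives a Lipschitz bound, and a limiting derivative as [l]
    controls the remainder of a difference quotient. *)
Lemma MVT_le (R : realType) (f df : R -> R) (a b l c : R) : a <= b ->
  (forall t, t \in `]a, b[%R -> is_derive t 1 f (df t)) ->
  {within `[a, b], continuous f} ->
  (forall t, t \in `]a, b[%R -> `|df t - l| <= c) ->
  `|f b - f a - l * (b - a)| <= c * (b - a).
Proof.
rewrite le_eqVlt => /predU1P[<-|ab] dfP fc dfc.
  by rewrite !subrr !mulr0 subrr normr0.
have [t tab ->] := MVT ab dfP fc.
have ba0 : 0 <= b - a by rewrite subr_ge0 ltW.
by rewrite -mulrBl normrM (ger0_norm ba0) ler_wpM2r ?dfc.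
Qed.

Lemma is_derive_coord (R : realType) n (y : R -> 'rV[R]_n) (t : R) (v : 'rV[R]_n) i :
  is_derive t 1 y v -> is_derive t 1 (fun s => y s ord0 i) (v ord0 i).
Proof.
move=> [yt yv]; split; first by move/derivable_mxP : yt; exact.
by rewrite -yv derive_mx// mxE.
Qed.

Lemma is_derive_row (R : realType) n (y : R -> 'rV[R]_n) (t : R) (v : 'rV[R]_n) :
  (forall i, is_derive t 1 (fun s => y s ord0 i) (v ord0 i)) ->
  is_derive t 1 y v.
Proof.
move=> yv; have yt : derivable y t 1.
  by apply/derivable_mxP => i j; rewrite (ord1 i); exact: (@ex_derive _ _ _ _ _ _ _ (yv j)).
split => //; rewrite derive_mx//; apply/rowP => i; rewrite mxE.
exact: (@derive_val _ _ _ _ _ _ _ (yv i)).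
Qed.

Lemma is_derive_cvg (R : realType) n (y : R -> 'rV[R]_n) (t : R) (v : 'rV[R]_n) :
  is_derive t 1 y v -> {for t, continuous y}.
Proof.
by move=> [/derivable1_diffP/differentiable_continuous].
Qed.

(** Vectors have no mean value equality, so the estimate is made coordinate by coordinate; with the
    sup norm this costs no factor [n]. *)
Lemma MVT_rV_le (R : realType) n (y dy : R -> 'rV[R]_n) (a b : R) (w : 'rV[R]_n) (c : R) :
  a <= b -> 0 <= c ->
  (forall t, t \in `]a, b[%R -> is_derive t 1 y (dy t)) ->
  {within `[a, b], continuous y} ->
  (forall t, t \in `]a, b[%R -> `|dy t - w| <= c) ->
  `|y b - y a - (b - a) *: w| <= c * (b - a).
Proof.
move=> ab c0 dyP yc dyc; apply: rV_norm_le => [|i].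
  by rewrite mulr_ge0// subr_ge0.
rewrite !mxE (mulrC (b - a)).
apply: (@MVT_le R (fun t => y t ord0 i) (fun t => dy t ord0 i)) => //.
- by move=> t /dyP; exact: is_derive_coord.
- move=> t.
  exact: (@continuous_comp (subspace `[a, b]) _ _ y
    (fun M : 'rV[R]_n => M ord0 i) t (yc t) (@coord_continuous _ _ _ _ _ _)).
- move=> t /dyc; apply: le_trans; have := ler_coord_norm (dy t - w) i.
  by rewrite !mxE.
Qed.

(** * C1 functions of several variables *)

Definition C1 (R : realType) n (f : 'rV[R]_n -> R) : Prop :=
  forall i, (forall x, derivable f x (ebasis R i)) /\ continuous (partial i f).

(** After regrouping the multiples of [e], both sides have the same difference quotient. *)
Lemma is_derive_line (R : realType) n (f : 'rV[R]_n -> R) (e z : 'rV[R]_n)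
    (s t : R) :
  derivable f (z + (t - s) *: e) e ->
  is_derive t 1 (fun t => f (z + (t - s) *: e)) ('D_e f (z + (t - s) *: e)).
Proof.
have E : (fun h : R => h^-1 *: (f (h *: e + (z + (t - s) *: e))
            - f (z + (t - s) *: e))) =
         (fun h : R => h^-1 *: (f (z + (h *: 1 + t - s) *: e)
            - f (z + (t - s) *: e))).
  apply/funext => h.
  suff -> : h *: e + (z + (t - s) *: e) = z + (h *: 1 + t - s) *: e by [].
  by rewrite addrCA -scalerDl [h *: 1]mulr1 addrA.
by move=> fd; split; rewrite /derivable /derive /= -E.
Qed.

(** The endpoints come in either order because a coordinate moved in [increment_le] may go up or
    down. *)
Lemma MVT_between_le (R : realType) (f df : R -> R) (a b l c : R) :
  (forall t : R, is_derive t 1 f (df t)) ->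
  (forall t, Num.min a b <= t <= Num.max a b -> `|df t - l| <= c) ->
  `|f b - f a - l * (b - a)| <= c * `|b - a|.
Proof.
move=> fP dfc.
have fc x y : {within `[x, y], continuous f}.
  by apply: derivable_within_continuous => t _; exact: (@ex_derive _ _ _ _ _ _ _ (fP t)).
have [ab|/ltW ba] := leP a b.
  have -> : `|b - a| = b - a by rewrite ger0_norm ?subr_ge0.
  apply: (MVT_le ab) => // t; rewrite in_itv /= => /andP[/ltW ta /ltW tb].
  by apply: dfc; rewrite (min_l ab) (max_r ab) ta tb.
have -> : `|b - a| = a - b by rewrite distrC ger0_norm ?subr_ge0.
have -> : f b - f a - l * (b - a) = - (f a - f b - l * (a - b)) by ring.
rewrite normrN; apply: (MVT_le ba) => // t.
rewrite in_itv /= => /andP[/ltW ta /ltW tb].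
by apply: dfc; rewrite (min_r ba) (max_l ba) ta tb.
Qed.

(* Walk from [a] to [b] changing one coordinate at a time: all the
   intermediate points stay in the sup-norm ball. *)
Lemma increment_le (R : realType) n (f : 'rV[R]_n -> R) (c : 'I_n -> R)
    (e r : R) (p a b : 'rV[R]_n) :
  (forall i x, derivable f x (ebasis R i)) ->
  `|a - p| <= r -> `|b - p| <= r ->
  (forall z i, `|z - p| <= r -> `|partial i f z - c i| <= e) ->
  `|f b - f a - \sum_i c i * (b ord0 i - a ord0 i)| <= n%:R * e * `|b - a|.
Proof.
move=> fd ar br fc.
have r0 : 0 <= r := le_trans (normr_ge0 _) ar.
pose w k : 'rV[R]_n := \row_i (if (i < k)%N then b ord0 i else a ord0 i).
have w0 : w 0%N = a by apply/rowP => i; rewrite mxE.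
have wn : w n = b by apply/rowP => i; rewrite mxE ltn_ord.
have -> : f b - f a = \sum_(i < n) (f (w i.+1) - f (w i)).
  by rewrite -wn -w0 -(telescope_sumr (fun k => f (w k)) (leq0n n)) big_mkord.
rewrite -sumrB; apply: le_trans (ler_norm_sum _ _ _) _.
have -> : n%:R * e * `|b - a| = \sum_(i < n) e * `|b - a|.
  by rewrite sumr_const card_ord -mulrA mulr_natl.
apply: ler_sum => k _.
have wE t : w k + (t - a ord0 k) *: ebasis R k =
    \row_i (if i == k then t else w k ord0 i).
  apply/rowP => i; rewrite !mxE eqxx /=.
  have [->|ik] := eqVneq i k; rewrite ?ltnn ?mulr1 ?mulr0 ?addr0//.
  by rewrite addrC subrK.
have wS : w k.+1 = w k + (b ord0 k - a ord0 k) *: ebasis R k.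
  rewrite wE; apply/rowP => i; rewrite !mxE ltnS leq_eqVlt (inj_eq (@ord_inj n)).
  by have [->|] := eqVneq i k.
have wk : w k = w k + (a ord0 k - a ord0 k) *: ebasis R k.
  by rewrite subrr scale0r addr0.
rewrite wS [in X in _ - X - _]wk.
apply: le_trans (_ : e * `|b ord0 k - a ord0 k| <= _).
  apply: (@MVT_between_le R (fun t => f (w k + (t - a ord0 k) *: ebasis R k))
     (fun t => partial k f (w k + (t - a ord0 k) *: ebasis R k))).
    by move=> t; exact: is_derive_line.
  move=> t /andP[tl tu]; apply: fc; apply: rV_norm_le => // i.
  have ari : `|a ord0 i - p ord0 i| <= r.
    by have := ler_coord_norm (a - p) i; rewrite !mxE => /le_trans; exact.
  have bri : `|b ord0 i - p ord0 i| <= r.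
    by have := ler_coord_norm (b - p) i; rewrite !mxE => /le_trans; exact.
  rewrite wE !mxE; have [E|_] := eqVneq i k; last by case: ifP.
  move: ari bri tl tu; rewrite E !ler_norml => /andP[a1 a2] /andP[b1 b2].
  case: (leP (a ord0 k) (b ord0 k)) => _ tl tu; apply/andP; split; lra.
have e0 : 0 <= e by apply: le_trans (fc p k _); rewrite ?subrr ?normr0.
rewrite ler_wpM2l//; have := ler_coord_norm (b - a) k.
by rewrite !mxE.
Qed.

Lemma near_dist_le (R : realType) n (p : 'rV[R]_n) (r : R) :
  0 < r -> \forall z \near p, `|z - p| <= r.
Proof.
move=> r0; apply/nbhs_ballP; exists r => //= z.
by rewrite -ball_normE /ball_ /= distrC => /ltW.
Qed.

(** Both points vary, in a closed sup-norm ball: this is the box onto which [ex_local_solution]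
    projects. *)
Definition loclip (R : realType) n (V : normedModType R) (u : 'rV[R]_n -> V)
    (p : 'rV[R]_n) :=
  exists2 L : R, 0 < L & exists2 r : R, 0 < r &
    forall a b, `|a - p| <= r -> `|b - p| <= r -> `|u a - u b| <= L * `|a - b|.

Lemma C1_near (R : realType) n (f : 'rV[R]_n -> R) (p : 'rV[R]_n) (e : R) : C1 f -> 0 < e ->
  exists2 r : R, 0 < r & forall z i, `|z - p| <= r ->
    `|partial i f z - partial i f p| <= e.
Proof.
move=> fC1 e0.
have : \forall z \near p, forall i, `|partial i f z - partial i f p| <= e.
  apply: (@filter_forall _ _
    (fun i z => `|partial i f z - partial i f p| <= e) (nbhs p)) => i.
  by have /cvgrPdistC_le/(_ e e0) := (fC1 i).2 p.
(* Halving the radius trades the open ball for a closed one. *)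
move=> /nbhs_ballP[r /= r0 rP]; exists (r / 2); first by rewrite divr_gt0.
move=> z i zp; apply: rP; rewrite -ball_normE /ball_ /= distrC.
by apply: le_lt_trans zp _; rewrite ltr_pdivrMr// ltr_pMr// ltr1n.
Qed.

(** Near [p] every partial derivative is bounded by [M], so [increment_le] applies with all slopes
    [c i] equal to 0. The final [+ 1] keeps the constant positive when [n = 0]. *)
Lemma C1_loclip (R : realType) n (f : 'rV[R]_n -> R) (p : 'rV[R]_n) : C1 f -> loclip f p.
Proof.
move=> fC1; have [r r0 rP] := C1_near p fC1 ltr01.
pose M := 1 + \sum_i `|partial i f p|.
have M0 : 0 < M by rewrite ltr_pwDl// sumr_ge0.
exists (n%:R * M + 1); first by rewrite ltr_wpDl// mulr_ge0// ltW.
exists r => // a b ar br.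
have := @increment_le R n f (fun=> 0) M r p b a (fun i => (fC1 i).1) br ar.
rewrite big1 ?subr0; last by move=> i _; rewrite mul0r.
move=> H; apply: le_trans (H _) _; last by rewrite ler_wpM2r// lerDl.
move=> z i zr; rewrite subr0 -(subrK (partial i f p) (partial i f z)).
apply: le_trans (ler_normD _ _) _; apply: lerD; first exact: rP.
by rewrite (bigD1 i)//= lerDl sumr_ge0.
Qed.

Lemma loclip_continuous (R : realType) n (V : normedModType R)
  (u : 'rV[R]_n -> V) (p : 'rV[R]_n) : loclip u p -> {for p, continuous u}.
Proof.
move=> [L L0 [r r0 uL]]; apply/(@cvgrPdistC_le _ _ _ (nbhs p)) => e e0.
near=> z.
have zr : `|z - p| <= r.
  by near: z; exact: near_dist_le.
apply: le_trans (uL z p zr _) _; first by rewrite subrr normr0 ltW.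
rewrite -ler_pdivlMl//; near: z.
by apply: near_dist_le; rewrite mulr_gt0// invr_gt0.
Unshelve. all: by end_near. Qed.

(** Here [increment_le] does the work of total differentiability: the quotient of [f \o y] differs
    from [\sum_i c i * q h ord0 i] by at most [n * d * |q h|], where [d] is as small as desired and
    [q h] stays bounded. *)
Lemma C1_chain (R : realType) n (f : 'rV[R]_n -> R) (y : R -> 'rV[R]_n) (t : R)
    (v : 'rV[R]_n) : C1 f -> is_derive t 1 y v ->
  is_derive t 1 (f \o y) (\sum_i partial i f (y t) * v ord0 i).
Proof.
move=> fC1 yv; pose c i := partial i f (y t).
pose q (h : R) : 'rV[R]_n := h^-1 *: (y (h *: 1 + t) - y t).
have qv : q h @[h --> 0^'] --> v by case: yv => + <-.
have qi i : q h ord0 i @[h --> 0^'] --> v ord0 i.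
  by apply: (@cvg_comp _ _ _ q (fun M : 'rV[R]_n => M ord0 i) _ _ _ qv);
    exact: coord_continuous.
have Sq : (\sum_i c i * q h ord0 i) @[h --> 0^'] --> \sum_i c i * v ord0 i.
  by apply: cvg_big => [|i _]; [exact: add_continuous|apply: cvgM; [exact: cvg_cst|exact: qi]].
have yc : y (h *: 1 + t) @[h --> 0^'] --> y t.
  have := is_derive_cvg yv; rewrite /continuous_at => yc.
  have ht : (h *: (1 : R) + t) @[h --> 0^'] --> t.
    have -> : nbhs t = nbhs (0 + t) by rewrite add0r.
    apply: cvgD; last exact: cvg_cst.
    by under eq_fun do rewrite [_ *: 1]mulr1; apply: cvg_within.
  exact: (@cvg_comp _ _ _ _ y _ _ _ ht yc).
suff Q : h^-1 *: (f (y (h *: 1 + t)) - f (y t)) @[h --> 0^'] -->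
    \sum_i c i * v ord0 i.
  by split; [apply/cvg_ex; exists (\sum_i c i * v ord0 i)|exact: cvg_lim Q].
suff D : (h^-1 *: (f (y (h *: 1 + t)) - f (y t)) - \sum_i c i * q h ord0 i)
    @[h --> 0^'] --> (0 : R).
  have -> : (fun h : R => h^-1 *: (f (y (h *: 1 + t)) - f (y t))) =
      (fun h : R => h^-1 *: (f (y (h *: 1 + t)) - f (y t))
         - \sum_i c i * q h ord0 i + \sum_i c i * q h ord0 i).
    by apply/funext => h; rewrite subrK.
  have -> : nbhs (\sum_i c i * v ord0 i) = nbhs (0 + \sum_i c i * v ord0 i).
    by rewrite add0r.
  exact: (cvgD D Sq).
apply/cvgr0Pnorm_le => e e0.
have K0 : 0 < n%:R * (`|v| + 1) + 1 by rewrite ltr_wpDl// mulr_ge0// addr_ge0.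
(* Chosen so that [n * d * (|v| + 1) <= e]; the added 1 keeps the denominator nonzero. *)
pose d := e / (n%:R * (`|v| + 1) + 1).
have d0 : 0 < d by rewrite divr_gt0.
have [r r0 rP] := C1_near (y t) fC1 d0.
near=> h.
have yr : `|y (h *: 1 + t) - y t| <= r.
  by near: h; move/cvgrPdistC_le : yc; exact.
have q1 : `|q h| <= `|v| + 1.
  by near: h; apply: (cvgr_norm_le v qv); rewrite ltrDl.
have := @increment_le R n f c d r (y t) (y t) _ (fun i => (fC1 i).1) _ yr rP.
rewrite subrr normr0 => /(_ (ltW r0)) H.
have -> : \sum_i c i * q h ord0 i =
    h^-1 * \sum_i c i * (y (h *: 1 + t) ord0 i - y t ord0 i).
  by rewrite mulr_sumr; apply: eq_bigr => i _; rewrite !mxE mulrCA.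
rewrite -[_ *: (f _ - _)]/(_ * _) -mulrBr normrM.
apply: le_trans (ler_wpM2l _ H) _ => //.
rewrite mulrCA -normrZ -/(q h).
apply: (@le_trans _ _ (n%:R * d * (`|v| + 1))).
  by rewrite ler_wpM2l// mulr_ge0// ltW.
rewrite mulrAC -[leRHS](divfK (lt0r_neq0 K0)) -/d [leRHS]mulrC.
by rewrite ler_wpM2r ?(ltW d0)// lerDl.
Unshelve. all: by end_near. Qed.

(** * Local Lipschitz continuity of the field *)

Lemma loclip_cst (R : realType) n (V : normedModType R) (c : V) (p : 'rV[R]_n) :
  loclip (fun=> c) p.
Proof.
by exists 1 => //; exists 1 => // a b _ _; rewrite subrr normr0 mul1r.
Qed.

Lemma loclipD (R : realType) n (V : normedModType R) (u w : 'rV[R]_n -> V)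
  (p : 'rV[R]_n) : loclip u p -> loclip w p -> loclip (fun x => u x + w x) p.
Proof.
move=> [L L0 [r r0 uL]] [M M0 [s s0 wM]]; exists (L + M); first exact: addr_gt0.
exists (Num.min r s); first by rewrite lt_min r0 s0.
move=> a b; rewrite !le_min => /andP[ar as_] /andP[br bs].
rewrite opprD addrACA mulrDl; apply: le_trans (ler_normD _ _) _.
by rewrite lerD ?uL ?wM.
Qed.

Lemma loclip_sum (R : realType) n (V : normedModType R) (I : Type) (s : seq I)
    (u : I -> 'rV[R]_n -> V) (p : 'rV[R]_n) :
  (forall i, loclip (u i) p) -> loclip (fun x => \sum_(i <- s) u i x) p.
Proof.
move=> up; elim: s => [|i s IH].
  by under eq_fun do rewrite big_nil; exact: loclip_cst.
by under eq_fun do rewrite big_cons; exact: loclipD.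
Qed.

Lemma loclipM (R : realType) n (u w : 'rV[R]_n -> R) (p : 'rV[R]_n) :
  loclip u p -> loclip w p -> loclip (fun x => u x * w x) p.
Proof.
move=> [L L0 [r r0 uL]] [M M0 [s s0 wM]].
pose m := Num.min r s; have m0 : 0 < m by rewrite lt_min r0 s0.
have [mr ms] : m <= r /\ m <= s by rewrite !ge_min !lexx orbT.
(* [A] and [B] bound [u] and [w] on the common ball of radius [m]. *)
pose A := `|u p| + L * m; pose B := `|w p| + M * m.
have A0 : 0 < A by rewrite ltr_wpDl// mulr_gt0.
have B0 : 0 < B by rewrite ltr_wpDl// mulr_gt0.
exists (A * M + B * L); first by rewrite addr_gt0// mulr_gt0.
exists m => // a b am bm.
have pr : `|p - p| <= m by rewrite subrr normr0 ltW.
have uA : `|u a| <= A.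
  rewrite -(subrK (u p) (u a)) addrC; apply: le_trans (ler_normD _ _) _.
  rewrite lerD2l; apply: le_trans (uL a p _ _) _; last by rewrite ler_wpM2l// ltW.
    exact: le_trans am mr.
  exact: le_trans pr mr.
have wB : `|w b| <= B.
  rewrite -(subrK (w p) (w b)) addrC; apply: le_trans (ler_normD _ _) _.
  rewrite lerD2l; apply: le_trans (wM b p _ _) _; last by rewrite ler_wpM2l// ltW.
    exact: le_trans bm ms.
  exact: le_trans pr ms.
have -> : u a * w a - u b * w b = u a * (w a - w b) + w b * (u a - u b) by ring.
apply: le_trans (ler_normD _ _) _; rewrite !normrM mulrDl -!mulrA.
apply: lerD; apply: ler_pM => //.
  by apply: wM; [exact: le_trans am ms|exact: le_trans bm ms].
by apply: uL; [exact: le_trans am mr|exact: le_trans bm mr].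
Qed.

Lemma loclip_comp (R : realType) n (u : 'rV[R]_n -> R) (h : R -> R)
    (p : 'rV[R]_n) :
  loclip u p ->
  (exists2 M : R, 0 < M & exists2 d : R, 0 < d &
     forall x y, `|x - u p| <= d -> `|y - u p| <= d ->
       `|h x - h y| <= M * `|x - y|) ->
  loclip (fun x => h (u x)) p.
Proof.
move=> [L L0 [r r0 uL]] [M M0 [d d0 hM]]; exists (M * L); first exact: mulr_gt0.
(* The radius [d / L] keeps the values of [u] within [d] of [u p], where [h] is Lipschitz. *)
have dL : 0 < d / L by rewrite divr_gt0.
exists (Num.min r (d / L)); first by rewrite lt_min r0 dL.
have pr : `|p - p| <= r by rewrite subrr normr0 ltW.
move=> a b; rewrite !le_min => /andP[ar ad] /andP[br bd].
rewrite -mulrA; apply: le_trans (hM _ _ _ _) _; last by rewrite ler_pM2l// uL.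
  apply: le_trans (uL a p ar pr) _; by rewrite mulrC -ler_pdivlMr.
by apply: le_trans (uL b p br pr) _; rewrite mulrC -ler_pdivlMr.
Qed.

(** Within [c / 2] of [c = u p] all values are at least [c / 2], so [1/x - 1/y = (y - x)/(x y)]
    yields the constant [(c / 2)^-2]. *)
Lemma loclip_inv (R : realType) n (u : 'rV[R]_n -> R) (p : 'rV[R]_n) :
  loclip u p -> 0 < u p -> loclip (fun x => (u x)^-1) p.
Proof.
move=> up c0; apply: (loclip_comp up); set c := u p in c0 *.
exists ((c / 2)^-1 * (c / 2)^-1); first by rewrite mulr_gt0// invr_gt0 divr_gt0.
exists (c / 2) => [|x y]; first by rewrite divr_gt0.
move=> /ler_normlP[x1 _] /ler_normlP[y1 _].
have xc : c / 2 <= x by lra.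
have yc : c / 2 <= y by lra.
have c2 : 0 < c / 2 by rewrite divr_gt0.
have x0 := lt_le_trans c2 xc; have y0 := lt_le_trans c2 yc.
have -> : x^-1 - y^-1 = (x^-1 * y^-1) * (y - x).
  by field; rewrite !gt_eqF.
rewrite normrM distrC ler_wpM2r// ger0_norm ?mulr_ge0 ?invr_ge0 ?(ltW x0) ?(ltW y0)//.
by rewrite ler_pM ?invr_ge0 ?(ltW x0) ?(ltW y0)// lef_pV2 ?posrE.
Qed.

(** With the same margin [c / 2], factor [x - y] as the sum times the difference of the square
    roots; the sum is at least [Num.sqrt (c / 2)]. *)
Lemma loclip_sqrt (R : realType) n (u : 'rV[R]_n -> R) (p : 'rV[R]_n) :
  loclip u p -> 0 < u p -> loclip (fun x => Num.sqrt (u x)) p.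
Proof.
move=> up c0; apply: (loclip_comp up); set c := u p in c0 *.
have c2 : 0 < c / 2 by rewrite divr_gt0.
have m0 : 0 < Num.sqrt (c / 2) by rewrite sqrtr_gt0.
exists (Num.sqrt (c / 2))^-1; first by rewrite invr_gt0.
exists (c / 2) => // x y.
move=> /ler_normlP[x1 _] /ler_normlP[y1 _].
have xc : c / 2 <= x by lra.
have yc : c / 2 <= y by lra.
have sxc : Num.sqrt (c / 2) <= Num.sqrt x by rewrite ler_wsqrtr.
have x0 := lt_le_trans c2 xc; have y0 := lt_le_trans c2 yc.
rewrite ler_pdivlMl//.
have -> : x - y = (Num.sqrt x + Num.sqrt y) * (Num.sqrt x - Num.sqrt y).
  by rewrite mulrC -subr_sqr !sqr_sqrtr// ltW.
rewrite normrM ler_wpM2r// ger0_norm ?addr_ge0 ?sqrtr_ge0//.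
by apply: le_trans sxc _; rewrite lerDl sqrtr_ge0.
Qed.

Lemma loclip_row (R : realType) n m (u : 'rV[R]_n -> 'rV[R]_m) (p : 'rV[R]_n) :
  (forall i, loclip (fun x => u x ord0 i) p) -> loclip u p.
Proof.
move=> up.
have {}up i : exists Lr : R * R, [/\ 0 < Lr.1, 0 < Lr.2 &
    forall a b, `|a - p| <= Lr.2 -> `|b - p| <= Lr.2 ->
    `|u a ord0 i - u b ord0 i| <= Lr.1 * `|a - b|].
  by have [L L0 [r r0 uL]] := up i; exists (L, r).
have [k kP] := choice up.
have L0 : 0 <= \sum_i (k i).1 by apply: sumr_ge0 => i _; case: (kP i) => /ltW.
have r0 : 0 <= \sum_i (k i).2^-1.
  by apply: sumr_ge0 => i _; rewrite invr_ge0; case: (kP i) => _ /ltW.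
(* The sum of the constants replaces their maximum, and the inverse of the sum of inverse radii
   replaces the minimal radius; adding 1 keeps both positive when there is no coordinate. *)
exists (\sum_i (k i).1 + 1); first by rewrite ltr_wpDl.
have r1 : 0 < \sum_i (k i).2^-1 + 1 by rewrite ltr_wpDl.
exists (\sum_i (k i).2^-1 + 1)^-1; first by rewrite invr_gt0.
move=> a b ar br; apply: rV_norm_le => [|i].
  by rewrite mulr_ge0// addr_ge0.
have [L1 r2 uk] := kP i.
have rk : (\sum_i (k i).2^-1 + 1)^-1 <= (k i).2.
  rewrite -[leRHS]invrK lef_pV2 ?posrE ?invr_gt0//.
  rewrite (bigD1 i)//= -addrA lerDl addr_ge0// sumr_ge0// => j _.
  by rewrite invr_ge0; case: (kP j) => _ /ltW.
rewrite !mxE; apply: le_trans (uk a b (le_trans ar rk) (le_trans br rk)) _.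
rewrite ler_wpM2r// (bigD1 i)//= -addrA lerDl addr_ge0// sumr_ge0// => j _.
by case: (kP j) => /ltW.
Qed.

Lemma C2_C1 (R : realType) n (f : 'rV[R]_n -> R) : C2 f -> C1 f.
Proof. by move=> fC i; have [? []] := fC i. Qed.

Lemma C2_partial (R : realType) n (f : 'rV[R]_n -> R) i : C2 f -> C1 (partial i f).
Proof. by move=> fC j; have [_ [_ /(_ j)]] := fC i. Qed.

Lemma loclip_eucl_grad (R : realType) n (f : 'rV[R]_n -> R) (p : 'rV[R]_n) :
  C2 f -> grad f p != 0 -> loclip (fun x => eucl (grad f x)) p.
Proof.
move=> fC fp; apply: loclip_sqrt; last by rewrite -sqr_eucl exprn_gt0// eucl_gt0.
apply: loclip_sum => i.
rewrite (_ : (fun x => _) = (fun x => partial i f x * partial i f x)).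
  by apply: loclipM; apply: C1_loclip; exact: C2_partial.
by apply/funext => x; rewrite mxE expr2.
Qed.

(** Second derivatives enter here: the partial derivatives are [C1], hence locally Lipschitz, and
    nonzero gradients keep the square roots and inverses away from 0. *)
Lemma loclip_sfield (R : realType) n (f g : 'rV[R]_n -> R) (z : R) (p : 'rV[R]_n) :
  C2 f -> C2 g -> grad f p != 0 -> grad g p != 0 -> loclip (sfield f g z) p.
Proof.
move=> fC gC fp gp; apply: loclip_row => i.
rewrite (_ : (fun x => _) = fun x =>
    (- 1) * ((eucl (grad f x))^-1 * partial i f x) +
    (- z) * ((eucl (grad g x))^-1 * partial i g x)); last first.
  by apply/funext => x; rewrite !mxE; ring.
apply: loclipD; (apply: loclipM; first exact: loclip_cst).
  apply: loclipM; last by apply: C1_loclip; exact: C2_partial.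
  by apply: loclip_inv; [exact: loclip_eucl_grad|exact: eucl_gt0].
apply: loclipM; last by apply: C1_loclip; exact: C2_partial.
by apply: loclip_inv; [exact: loclip_eucl_grad|exact: eucl_gt0].
Qed.

Lemma sfield_norm_le (R : realType) n (f g : 'rV[R]_n -> R) (z : R) (p : 'rV[R]_n) :
  0 <= z <= 1 -> `|sfield f g z p| <= 2.
Proof.
move=> /andP[z0 z1].
have unit_le (v : 'rV[R]_n) : `|(eucl v)^-1 *: v| <= 1.
  rewrite normrZ ger0_norm ?invr_ge0 ?sqrtr_ge0//.
  (* With the convention [0^-1 = 0], normalizing the zero vector gives zero. *)
  have [->|v0] := eqVneq (eucl v) 0; first by rewrite invr0 mul0r.
  by rewrite ler_pdivrMl ?mulr1 ?ler_norm_eucl// lt_def v0 sqrtr_ge0.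
rewrite /sfield; apply: le_trans (ler_normB _ _) _; rewrite normrN -scalerA (normrZ z).
have -> : (2 : R) = 1 + 1 * 1 by rewrite mulr1.
by apply: lerD => //; apply: ler_pM => //; rewrite ger0_norm.
Qed.

(* The two unit vectors have inner product at least [-1]. *)
Lemma dot_sfield_le (R : realType) n (f g : 'rV[R]_n -> R) (z : R) (p : 'rV[R]_n) :
  0 <= z -> grad f p != 0 -> grad g p != 0 ->
  \sum_i partial i f p * sfield f g z p ord0 i <= - (1 - z) * eucl (grad f p).
Proof.
move=> z0 fp gp; set a := eucl (grad f p); set b := eucl (grad g p).
have a0 : 0 < a by exact: eucl_gt0.
have b0 : 0 < b by exact: eucl_gt0.
have unit (v : 'rV[R]_n) : v != 0 -> eucl ((eucl v)^-1 *: v) = 1.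
  move=> v0; have e0 := eucl_gt0 v0.
  rewrite {1}/eucl; under eq_bigr do rewrite mxE exprMn.
  by rewrite -mulr_sumr -sqr_eucl -exprMn mulVf ?gt_eqF// expr1n sqrtr1.
have D := dot_unit_geN1 (unit _ fp) (unit _ gp).
(* [S] is the inner product of the gradients, and [D] turns into [- a * b <= S], divided by
   [a * b]. *)
pose S := \sum_i partial i f p * partial i g p.
have {}D : - 1 <= a^-1 * b^-1 * S.
  rewrite mulr_sumr; apply: le_trans D _; apply: ler_sum => i _.
  by rewrite !mxE -/a -/b le_eqVlt; apply/orP; left; apply/eqP; ring.
have -> : \sum_i partial i f p * sfield f g z p ord0 i =
    - a^-1 * a ^+ 2 - z * b^-1 * S.
  rewrite sqr_eucl !mulr_sumr -sumrB; apply: eq_bigr => i _.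
  by rewrite !mxE -/a -/b; ring.
have -> : - a^-1 * a ^+ 2 = - a by field; rewrite gt_eqF.
have : - a <= b^-1 * S.
  have := ler_wpM2l (ltW a0) D; rewrite mulrN1 !mulrA divff ?gt_eqF// mul1r.
  exact.
move=> /(ler_wpM2l z0); rewrite mulrA; lra.
Qed.

(** * Local existence for Lipschitz fields *)

(** Integrating from [- h - 1] on a window up to [h + 1] makes every [|t| <= h] an interior point,
    negative [t] included, so the fundamental theorem gives two-sided derivatives. *)
Lemma ex_primitive (R : realType) (u : R -> R) (h : R) : continuous u ->
  exists U : R -> R, U 0 = 0 /\
    forall t : R, `|t| <= h -> is_derive t 1 U (u t).
Proof.
move=> uc.
have ui : lebesgue_measure.-integrable `[- h - 1, h + 1] (EFin \o u).
  apply: continuous_compact_integrable; first exact: segment_compact.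
  exact: continuous_subspaceT.
pose F x := (\int[lebesgue_measure]_(t in [set` `[- h - 1, x]]) u t)%R.
have FP (t : R) : `|t| <= h -> is_derive t 1 F (u t).
  move=> /ler_normlP[t1 t2].
  have th : t < h + 1 by lra.
  have ht : - h - 1 < t by lra.
  have [F1 F2] := continuous_FTC1_closed th ui ht (uc t).
  by split; [exact: F1|rewrite -derive1E; exact: F2].
exists (fun t => F t - F 0); split; first by rewrite subrr.
move=> t /FP Ft; rewrite -[u t]subr0.
by apply: is_deriveB.
Qed.

Lemma ex_primitive_rV (R : realType) n (u : R -> 'rV[R]_n) (h : R) :
  continuous u ->
  exists U : R -> 'rV[R]_n, U 0 = 0 /\
    forall t : R, `|t| <= h -> is_derive t 1 U (u t).
Proof.
move=> uc.
have /choice[U UP] : forall i, exists U : R -> R, U 0 = 0 /\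
    forall t : R, `|t| <= h -> is_derive t 1 U (u t ord0 i).
  move=> i; apply: (@ex_primitive R (fun t => u t ord0 i)) => t.
  exact: (@continuous_comp _ _ _ u (fun M : 'rV[R]_n => M ord0 i) t (uc t)
    (@coord_continuous _ _ _ _ _ _)).
exists (fun t => \row_i U i t); split.
  by apply/rowP => i; rewrite !mxE; case: (UP i).
move=> t th; apply: is_derive_row => i.
by under eq_fun do rewrite mxE; apply: (UP i).2.
Qed.

(** Serves twice: to extend curves by constants in [picard_step], and coordinatewise to project onto
    a box in [ex_local_solution]. *)
Definition clamp (R : realType) (a b t : R) : R := Num.max a (Num.min t b).

Lemma clamp_in (R : realType) (a b t : R) : a <= b -> a <= clamp a b t <= b.
Proof.
by move=> ab; rewrite /clamp le_max lexx /= ge_max ab ge_min lexx orbT.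
Qed.

Lemma clamp_id (R : realType) (a b t : R) : a <= t <= b -> clamp a b t = t.
Proof. by move=> /andP[at_ tb]; rewrite /clamp (min_l tb) (max_r at_). Qed.

(** Clamping is monotone and grows no faster than the identity. *)
Lemma clamp_dist (R : realType) (a b s t : R) :
  `|clamp a b s - clamp a b t| <= `|s - t|.
Proof.
have H x y : x <= y -> clamp a b x <= clamp a b y <= clamp a b x + (y - x).
  move=> xy; rewrite /clamp.
  case: (leP x b) => xb; case: (leP y b) => yb;
    [case: (leP a x) => ax; case: (leP a y) => ay|case: (leP a x) => ax;
    case: (leP a b) => ab|case: (leP a b) => ab; case: (leP a y) => ay|
    case: (leP a b) => ab]; apply/andP; split; lra.
wlog st : s t / s <= t => [W|].
  have [st|/ltW ts] := leP s t; first exact: W.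
  by rewrite distrC (distrC s); exact: W.
have /andP[c1 c2] := H _ _ st.
rewrite distrC ger0_norm ?subr_ge0// distrC ger0_norm ?subr_ge0//; lra.
Qed.

Lemma dist_continuous (R : realType) (V W : normedModType R) (u : V -> W) (L : R) :
  0 < L -> (forall a b, `|u a - u b| <= L * `|a - b|) -> continuous u.
Proof.
move=> L0 uL p; apply/(@cvgrPdistC_le _ _ _ (nbhs p)) => e e0.
apply/nbhs_ballP; exists (e / L) => /=; first by rewrite divr_gt0.
move=> z; rewrite -ball_normE /ball_ /= distrC => /ltW zp.
by apply: le_trans (uL z p) _; rewrite mulrC -ler_pdivlMr.
Qed.

(** * Picard iteration for a globally Lipschitz field *)

Section picard_iteration.
Variables (R : realType) (n : nat) (S : 'rV[R]_n -> 'rV[R]_n) (L h : R).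
Variable p : 'rV[R]_n.
Hypotheses (L0 : 0 < L) (h0 : 0 < h) (hL : h * L <= 2^-1).
Hypothesis SL : forall a b, `|S a - S b| <= L * `|a - b|.

(* [w t = p + int_0^t S (z s) ds] for [|t| <= h], extended by constants. *)
Definition picard_step (z w : R -> 'rV[R]_n) : Prop :=
  [/\ continuous w, w 0 = p, (forall t, w t = w (clamp (- h) h t)) &
      forall t : R, `|t| < h -> is_derive t 1 w (S (z t))].

Lemma picard_stepP z : continuous z -> exists w, picard_step z w.
Proof.
move=> zc; have Sc : continuous S := dist_continuous L0 SL.
have [|U [U0 UP]] := @ex_primitive_rV R n (S \o z) h.
  by move=> t; apply: continuous_comp; [exact: zc|exact: Sc].
have h_gt0 := h0.
have hh : - h <= h by lra.
have cc : continuous (clamp (- h) h).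
  apply: (@dist_continuous R R^o R^o _ 1) => // s t.
  by rewrite mul1r; exact: clamp_dist.
exists (fun t => p + U (clamp (- h) h t)); split.
- move=> t; apply: cvgD; first exact: cvg_cst.
  apply: (@continuous_comp _ _ _ (clamp (- h) h) U); first exact: cc.
  apply: (is_derive_cvg (v := (S \o z) (clamp (- h) h t))).
  by apply: UP; rewrite ler_norml clamp_in.
- by rewrite clamp_id ?U0 ?addr0//; apply/andP; split; lra.
- by move=> t; rewrite (clamp_id (t := clamp _ _ _))// clamp_in.
- move=> t th; have Ut : is_derive t 1 (fun t => p + U t) (S (z t)).
    by have UPt := UP t (ltW th); rewrite -[S _]add0r; apply: is_deriveD.
  (* Since [|t| < h] is an open condition, the clamp is the identity near [t]. *)
  apply: near_eq_is_derive Ut; near=> s.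
  rewrite clamp_id// -ler_norml.
  by near: s; apply: (cvgr_norm_le t) => //; exact: cvg_id.
Unshelve. all: by end_near. Qed.

(** The difference of the images vanishes at 0 and has derivative at most [L * d] over a length at
    most [h]; then [h * L <= 1/2] gives the factor one half. *)
Lemma picard_step_contract z z' w w' (d : R) : picard_step z w ->
  picard_step z' w' -> (forall t, `|z t - z' t| <= d) ->
  forall t, `|w t - w' t| <= d / 2.
Proof.
move=> [wc w0 wC wD] [wc' w0' wC' wD'] zd t; have h_gt0 := h0.
rewrite wC wC'; set s := clamp _ _ _.
have sh : - h <= s <= h by apply: clamp_in; lra.
have d0 : 0 <= d by apply: le_trans (zd 0).
have K a b : a <= b -> - h <= a -> b <= h -> b - a <= h ->
    `|w b - w' b - (w a - w' a)| <= d / 2.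
  move=> ab ha bh bah.
  have := @MVT_rV_le R n (fun t => w t - w' t) (fun t => S (z t) - S (z' t))
     a b 0 (L * d) ab.
  rewrite scaler0 subr0 => H; apply: le_trans (H _ _ _ _) _.
  - by rewrite mulr_ge0// ltW.
  - move=> r; rewrite in_itv /= => /andP[ar rb].
    have rh : `|r| < h by rewrite ltr_norml; apply/andP; split; lra.
    by apply: is_deriveB; [exact: wD|exact: wD'].
  - by apply: continuous_subspaceT => r; apply: cvgB; [exact: wc|exact: wc'].
  - move=> r _; rewrite subr0; apply: le_trans (SL _ _) _.
    by apply: ler_wpM2l; [exact: ltW|exact: zd].
  - apply: (@le_trans _ _ (L * d * h)); first by rewrite ler_wpM2l// mulr_ge0// ltW.
    have -> : L * d * h = d * (h * L) by ring.
    by rewrite ler_wpM2l.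
have [s0|/ltW s0] := leP 0 s.
  have := K 0 s s0; rewrite w0 w0' subrr !subr0; apply; lra.
have := K s 0 s0; rewrite w0 w0' subrr !sub0r normrN; apply; lra.
Qed.

Lemma ex_picard_fixpoint : exists y : R -> 'rV[R]_n,
  y 0 = p /\ forall t : R, `|t| < h -> is_derive t 1 y (S (y t)).
Proof.
have h_gt0 := h0.
(* [F] takes arbitrary values at discontinuous arguments; the iterates are continuous by
   induction. *)
have /choice[F FP] : forall z : R -> 'rV[R]_n, exists w, continuous z -> picard_step z w.
  move=> z; have [zc|zc] := pselect (continuous z); last by exists z.
  by have [w wP] := picard_stepP zc; exists w.
pose Z k : R -> 'rV[R]_n := iter k F (fun=> p).
have Zc k : continuous (Z k).
  elim: k => [|k IH]; first by move=> t; exact: cvg_cst.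
  by have [] := FP _ IH.
have ZP k : picard_step (Z k) (Z k.+1) by exact: FP (Zc k).
(* The clamp makes the first iterate factor through the compact [[-h, h]], so it is bounded on the
   whole line. *)
have [C C0 ZC] : exists2 C : R, 0 < C & forall t, `|Z 1%N t - Z 0%N t| <= C.
  have [c _ wC _] := ZP 0%N.
  have : compact (Z 1%N @` `[- h, h]).
    apply: continuous_compact; last exact: segment_compact.
    exact: continuous_subspaceT.
  move=> /compact_bounded[M [_ /(_ (M + 1))]]; rewrite ltrDl ltr01 => /(_ isT) MP.
  exists (`|M + 1| + `|p| + 1); first by rewrite ltr_wpDl// addr_ge0.
  move=> t; apply: le_trans (ler_normB _ _) _; rewrite -addrA; apply: lerD.
    apply: le_trans (ler_norm _); apply: MP; rewrite wC.
    exists (clamp (- h) h t) => //; rewrite /= in_itv /=; apply: clamp_in; lra.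
  by rewrite lerDl.
have Zd k t : `|Z k.+1 t - Z k t| <= C / 2 ^+ k.
  elim: k t => [|k IH] t; first by rewrite expr0 divr1.
  rewrite exprS invfM mulrCA mulrC.
  exact: (picard_step_contract (ZP k.+1) (ZP k) IH).
(* The partial geometric sum is kept exact, so the induction step closes by an equality. *)
have Zkm k m t : `|Z (k + m)%N t - Z k t| <= 2 * C / 2 ^+ k - 2 * C / 2 ^+ (k + m).
  elim: m => [|m IH]; first by rewrite addn0 !subrr normr0.
  rewrite addnS -(subrK (Z (k + m)%N t) (Z _.+1 t)) -addrA.
  apply: le_trans (ler_normD _ _) _; apply: le_trans (lerD (Zd _ _) IH) _.
  rewrite exprS invfM le_eqVlt; apply/orP; left; apply/eqP; field.
  by rewrite !expf_neq0//.
have Zb k m t : (k <= m)%N -> `|Z m t - Z k t| <= 2 * C / 2 ^+ k.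
  move=> km; rewrite -(subnKC km); apply: le_trans (Zkm _ _ _) _.
  by rewrite gerBl divr_ge0// ?exprn_ge0// mulr_ge0// ltW.
have small e : 0 < e -> exists k, 2 * C / 2 ^+ k <= e.
  move=> e0.
  have : (geometric (2 * C) (2^-1 : R)) @ \oo --> 0.
    by apply: cvg_geometric; rewrite ger0_norm ?invr_ge0// invf_lt1// ltr1n.
  move=> /cvgrPdistC_le/(_ e e0)[N _ /(_ N (leqnn N))]; rewrite subr0 /= => H.
  by exists N; rewrite -exprVn; apply: le_trans (ler_norm _) H.
have lim_ex (t : R) : exists l : 'rV[R]_n, (fun k => Z k t) @ \oo --> l.
  suff : cvg ((fun k => Z k t) @ \oo)
    by move=> Zt; exists (lim ((fun k => Z k t) @ \oo)); exact: Zt.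
  apply/cauchy_cvgP; apply: cauchy_exP => e e0.
  have e2 : 0 < e / 2 by rewrite divr_gt0.
  have [k ke] := small _ e2; exists (Z k t); exists k => // m /= km.
  rewrite -ball_normE /ball_ /= distrC; apply: le_lt_trans (Zb k m t km) _.
  apply: le_lt_trans ke _; lra.
have [y yP] := choice lim_ex.
have yZ k t : `|y t - Z k t| <= 2 * C / 2 ^+ k.
  apply/ler_addgt0Pr => e e0.
  have /cvgrPdist_le/(_ e e0)[N _ NP] := yP t.
  rewrite -(subrK (Z (maxn N k) t) (y t)) -addrA addrC.
  apply: le_trans (ler_normD _ _) _; apply: lerD.
    by apply: Zb; exact: leq_maxr.
  by apply: NP; exact: leq_maxl.
have yc : continuous y.
  move=> t; apply/(@cvgrPdistC_le _ _ _ (nbhs t)) => e e0.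
  have e3 : 0 < e / 3 by rewrite divr_gt0.
  have [k ke] := small _ e3.
  have /(@cvgrPdistC_le _ _ _ (nbhs t))/(_ _ e3) := Zc k t.
  apply: filterS => s sk.
  have := le_trans (yZ k s) ke; have := le_trans (yZ k t) ke; rewrite distrC => H1 H2.
  have -> : y s - y t = (y s - Z k s) + (Z k s - Z k t) + (Z k t - y t).
    by rewrite !subrKA.
  have -> : e = e / 3 + e / 3 + e / 3 by field.
  by do 2 (apply: le_trans (ler_normD _ _) _; apply: lerD => //).
have [wc w0 wC wD] := FP _ yc.
(* Both [F y] and [y] are uniform limits of the iterates, the former by contraction. *)
have wy t : F y t = y t.
  apply/eqP; rewrite -subr_eq0 -normr_le0; apply/ler_addgt0Pr => e e0; rewrite add0r.
  have e2 : 0 < e / 2 by rewrite divr_gt0.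
  have [k ke] := small _ e2.
  have H1 := picard_step_contract (FP _ yc) (ZP k) (yZ k) t.
  have H2 := yZ k.+1 t; rewrite distrC in H2.
  rewrite -(subrK (Z k.+1 t) (F y t)) -addrA; apply: le_trans (ler_normD _ _) _.
  apply: le_trans (lerD H1 H2) _; rewrite exprS invfM.
  have -> : 2 * C / 2 ^+ k / 2 + 2 * C * (2^-1 / 2 ^+ k) = 2 * C / 2 ^+ k.
    by field; rewrite expf_neq0.
  by apply: le_trans ke _; lra.
exists (F y); split => // t th; rewrite wy; exact: wD.
Qed.
End picard_iteration.

(* Composing with the coordinatewise projection onto a box around [p], which
   is [1]-Lipschitz for the sup norm, makes the field globally Lipschitz. *)
Lemma ex_local_solution (R : realType) n (s : 'rV[R]_n -> 'rV[R]_n)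
    (p : 'rV[R]_n) : loclip s p ->
  exists2 h : R, 0 < h & exists y : R -> 'rV[R]_n,
    y 0 = p /\ forall t : R, `|t| < h -> is_derive t 1 y (s (y t)).
Proof.
move=> [L L0 [r r0 sL]].
pose c (x : 'rV[R]_n) : 'rV[R]_n :=
  \row_i clamp (p ord0 i - r) (p ord0 i + r) (x ord0 i).
have cr x : `|c x - p| <= r.
  apply: rV_norm_le => [|i]; first exact: ltW.
  have H : p ord0 i - r <= p ord0 i + r by lra.
  have /andP[c1 c2] := clamp_in (x ord0 i) H.
  by rewrite !mxE ler_norml; apply/andP; split; lra.
have cid x : `|x - p| <= r -> c x = x.
  move=> xr; apply/rowP => i; rewrite mxE clamp_id//.
  have := le_trans (ler_coord_norm _ i) xr; rewrite !mxE.
  by move=> /ler_normlP[x1 x2]; apply/andP; split; lra.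
have cd a b : `|c a - c b| <= `|a - b|.
  apply: rV_norm_le => // i; rewrite !mxE.
  apply: le_trans (clamp_dist _ _ _ _) _.
  by have := ler_coord_norm (a - b) i; rewrite !mxE.
pose h := (2 * L)^-1.
have h0 : 0 < h by rewrite invr_gt0 mulr_gt0.
have hL : h * L <= 2^-1 by rewrite /h invfM mulfVK ?gt_eqF.
have SL a b : `|s (c a) - s (c b)| <= L * `|a - b|.
  by apply: le_trans (sL _ _ (cr a) (cr b)) _; rewrite ler_pM2l.
have [y [y0 yP]] := ex_picard_fixpoint p L0 h0 hL SL.
have yc : {for 0, continuous y}.
  by apply: is_derive_cvg (yP 0 _); rewrite normr0.
(* For small times [y] stays in the box, where the projection [c] is the identity and the modified
   field is [s] itself. *)
have : \forall t \near (0 : R), `|y t - p| <= r.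
  by rewrite -y0; move/(@cvgrPdistC_le _ _ _ (nbhs (0 : R))) : yc; exact.
move=> /nbhs_ballP[d /= d0 dP].
exists (Num.min h d); first by rewrite lt_min h0 d0.
exists y; split => // t; rewrite lt_min => /andP[th td].
rewrite -[X in s X]cid; first exact: yP.
by apply: dP; rewrite -ball_normE /ball_ /= sub0r normrN.
Qed.

(** * Limit sets *)

(* If [U] were not in [F], the trace of [F] on the complement of [U] would be
   a proper filter with a cluster point outside [U]. *)
Lemma cluster_attracts (X : topologicalType) (F : set_system X) (K U : set X) :
  ProperFilter F -> compact K -> F K -> open U -> cluster F `<=` U -> F U.
Proof.
move=> FF cK FK oU clU; apply: contrapT => FU.
have GF : ProperFilter (within (~` U) F).
  apply: Build_ProperFilter => F0; apply: FU.
  by apply: (@filterS _ F _ _ _ _ F0) => z /= Uz; apply: contrapT => /Uz.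
have GK : within (~` U) F K by apply: (@filterS _ F _ _ _ _ FK) => z Kz _.
have [p [_ clp]] := cK _ GF GK.
have Up : U p.
  apply: clU => A B FA Bp; apply: clp => //.
  by apply: (@filterS _ F _ _ _ _ FA) => z Az _.
have GU : within (~` U) F (~` U) by apply: nearW.
by have [z []] := clp _ _ GU (open_nbhs_nbhs (conj oU Up)).
Qed.

Lemma cluster_closed (X : topologicalType) (F : set_system X) : closed (cluster F).
Proof.
rewrite clusterE; apply: closed_bigI => A _; exact: closed_closure.
Qed.

(** If the cluster set split, normality would give disjoint open sets around the two pieces. Their
    union belongs to [F], hence contains a connected member of [F]; this lies in one of them, yet
    every member meets both. *)
Lemma cluster_connected (R : realType) (X : pseudoMetricType R)
    (F : set_system X) (K : set X) :
  hausdorff_space X -> ProperFilter F -> compact K -> F K ->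
  (forall A, F A -> exists B, [/\ B `<=` A, F B & connected B]) ->
  connected (cluster F).
Proof.
move=> hX FF cK FK base; apply/connectedP => E [E0 EF [sep1 sep2]].
(* A limit of one piece is again a cluster point, and separation keeps it out of the other piece. *)
have clE b : closed (E b).
  move=> z clz; have : cluster F z.
    apply: (@cluster_closed _ F); rewrite EF => B Bz.
    by have [w [Ew Bw]] := clz _ Bz; exists w; split=> //; case: (b) Ew; [right|left].
  rewrite EF; case: b clz => clz [] // Ez; exfalso.
    by have : (E false `&` closure (E true)) z by []; rewrite sep2.
  by have : (closure (E false) `&` E true) z by []; rewrite sep1.
have E01 : E false `&` E true = set0.
  rewrite -subset0 => z [z0 z1]; rewrite -sep1; split => //; exact: subset_closure.
have [U [V [oU oV EU EV UV]]] :=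
  (normal_openP (R := R)).1 (@pseudometric_normal R X) _ _ (clE false) (clE true) E01.
have FUV : F (U `|` V).
  apply: (cluster_attracts FF cK FK); first exact: openU.
  by rewrite EF; apply: setUSS.
have [B [BUV FB cB]] := base _ FUV.
have sepUV : separated U V.
  have H (C D : set X) : open D -> C `&` D = set0 -> closure C `&` D = set0.
    move=> oD CD; rewrite -subset0 => z [clz Dz].
    by have [w] := clz _ (open_nbhs_nbhs (conj oD Dz)); rewrite CD.
  split; first exact: H.
  by rewrite setIC; apply: H; rewrite // setIC.
have meet b (W : set X) : open W -> E b `<=` W -> B `&` W !=set0.
  move=> oW EW; have [z Ez] := E0 b.
  have clz : cluster F z by rewrite EF; case: (b) Ez; [right|left].
  exact: clz _ _ FB (open_nbhs_nbhs (conj oW (EW _ Ez))).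
have [BU|BV] := connected_subset sepUV BUV cB.
  have [z [Bz Vz]] := meet true _ oV EV.
  by suff : (U `&` V) z; [rewrite UV|split => //; exact: BU].
have [z [Bz Uz]] := meet false _ oU EU.
by suff : (U `&` V) z; [rewrite UV|split => //; exact: BV].
Qed.

(** The mean value inequality between [t0] and [t0 + h] bounds the quotient minus [w] by [e]. This
    differentiates a glued curve at its junction. *)
Lemma is_derive_limit (R : realType) n (y dy : R -> 'rV[R]_n) (t0 r : R)
    (w : 'rV[R]_n) : 0 < r ->
  (forall t : R, 0 < `|t - t0| < r -> is_derive t 1 y (dy t)) ->
  {for t0, continuous y} ->
  (forall e : R, 0 < e -> exists2 d : R, 0 < d &
     forall t, 0 < `|t - t0| < d -> `|dy t - w| <= e) ->
  is_derive t0 1 y w.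
Proof.
move=> r0 yD yc dyw.
have yct t : `|t - t0| < r -> {for t, continuous y}.
  move=> tr; have [->//|tt] := eqVneq t t0.
  by apply: is_derive_cvg (yD t _); rewrite normr_gt0 subr_eq0 tt.
suff Q : h^-1 *: (y (h *: (1 : R) + t0) - y t0) @[h --> 0^'] --> w.
  by split; [apply/cvg_ex; exists w|exact: cvg_lim Q].
apply/cvgrPdistC_le => e e0; have [d d0 dP] := dyw e e0.
near=> h.
have hn : h != 0 by near: h; exact: nbhs_dnbhs_neq.
have hd : `|h| < Num.min r d.
  by near: h; apply: dnbhs0_lt; rewrite lt_min r0.
move: hd; rewrite lt_min => /andP[hr hd].
have -> : h *: (1 : R) + t0 = t0 + h by rewrite [h *: _]mulr1 addrC.
have -> : h^-1 *: (y (t0 + h) - y t0) - w = h^-1 *: (y (t0 + h) - y t0 - h *: w).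
  by rewrite [RHS]scalerBr scalerA mulVf// scale1r.
rewrite normrZ normfV ler_pdivrMl ?normr_gt0// mulrC.
(* Stated for any interval avoiding [t0] in its interior, so that it serves both signs of [h]. *)
have M a b : a <= b -> (forall t, a <= t <= b -> `|t - t0| <= `|h|) ->
    (forall t, a < t < b -> t != t0) ->
    `|y b - y a - (b - a) *: w| <= e * (b - a).
  move=> ab abh abn; apply: (@MVT_rV_le R n y dy a b w e ab (ltW e0)).
  - move=> t; rewrite in_itv /= => tab; apply: yD.
    rewrite normr_gt0 subr_eq0 abn//=; apply: le_lt_trans hr; apply: abh.
    by case/andP: tab => /ltW -> /ltW ->.
  - apply: continuous_in_subspaceT => t; rewrite inE /= in_itv /= => tab.
    by apply: yct; apply: le_lt_trans hr; exact: abh.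
  - move=> t; rewrite in_itv /= => tab; apply: dP.
    rewrite normr_gt0 subr_eq0 abn//=; apply: le_lt_trans hd; apply: abh.
    by case/andP: tab => /ltW -> /ltW ->.
have [h0|h0] := leP 0 h.
  have := M t0 (t0 + h); rewrite (addrC t0) addrK (ger0_norm h0); apply.
  - by rewrite lerDr.
  - by move=> t /andP[ta tb]; rewrite ger0_norm; lra.
  - by move=> t /andP[ta tb]; rewrite gt_eqF.
have := M (t0 + h) t0; rewrite ltr0_norm//.
have -> : t0 - (t0 + h) = - h by ring.
rewrite scaleNr opprK -normrN opprD opprB.
apply.
- by rewrite gerDl ltW.
- by move=> t /andP[ta tb]; rewrite ler0_norm; lra.
- by move=> t /andP[ta tb]; rewrite lt_eqF.
Unshelve. all: by end_near. Qed.

(** One filter treats a finite [T], approached from the left, and [T = +oo] alike. *)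
Definition left_end (R : realType) (T : \bar R) : set_system R :=
  filter_from [set t0 : R | (t0%:E < T)%E] (fun t0 => [set t | t0 < t /\ (t%:E < T)%E]).

Lemma lt_between (R : realType) (T : \bar R) (a : R) :
  (a%:E < T)%E -> exists2 b : R, a < b & (b%:E < T)%E.
Proof.
case: T => [r| |] //; last by exists (a + 1); [lra|exact: ltry].
by rewrite lte_fin => ar; exists ((a + r) / 2); rewrite ?lte_fin; lra.
Qed.

Lemma left_end_proper (R : realType) (T : \bar R) :
  (0 < T)%E -> ProperFilter (left_end T).
Proof.
move=> T0; apply: filter_from_proper.
  apply: filter_from_filter; first by exists 0.
  move=> a b /= aT bT; exists (Num.max a b) => /=.
    by case: (leP a b).
  by move=> t /=; rewrite gt_max => -[/andP[at_ bt] tT].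
by move=> a /= /lt_between[b ab bT]; exists b.
Qed.

(** Passing to cluster points makes compactness available; the Euclidean and sup norms are exchanged
    through [eucl_lt] and [ler_norm_eucl]. *)
Lemma limit_setE (R : realType) n (T : \bar R) (x : R -> 'rV[R]_n) :
  limit_set T x = cluster (x @ left_end T).
Proof.
apply/seteqP; split => p /=.
  move=> Lp A B [t0 t0T tA] /nbhs_ballP[e /= e0 eB].
  have [t [t0t [tT xt]]] := Lp e e0 t0 t0T; exists (x t); split.
    exact: tA.
  apply: eB; rewrite -ball_normE /ball_ /= distrC.
  by apply: le_lt_trans xt; exact: ler_norm_eucl.
move=> clp e e0 t0 t0T.
have xA : (x @ left_end T) (x @` [set t | t0 < t /\ (t%:E < T)%E]).
  by exists t0 => // t /= tt; exists t.
have e1 : 0 < e / n.+1%:R by rewrite divr_gt0.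
have [z [[t /= [t0t tT] <-]]] := clp _ _ xA (nbhsx_ballx p _ e1).
rewrite -ball_normE /ball_ /= distrC => /eucl_lt xt; exists t; do 2 split => //.
Qed.

(** * Behaviour of the trajectory *)

Lemma drop_along (R : realType) n (f : 'rV[R]_n -> R) (x dx : R -> 'rV[R]_n)
    (a b m : R) : C1 f -> a <= b ->
  (forall t : R, a <= t <= b -> is_derive t 1 x (dx t)) ->
  (forall t, a <= t <= b -> \sum_i partial i f (x t) * dx t ord0 i <= - m) ->
  f (x b) <= f (x a) - m * (b - a).
Proof.
move=> fC ab xD dm.
have fD (t : R) : a <= t <= b -> is_derive t 1 (f \o x)
    (\sum_i partial i f (x t) * dx t ord0 i).
  by move=> /xD; exact: C1_chain.
have [||c cab E] := @MVT_segment R (f \o x)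
    (fun t => \sum_i partial i f (x t) * dx t ord0 i) a b ab.
- by move=> t; rewrite in_itv /= => /andP[/ltW ta /ltW tb]; apply: fD; rewrite ta.
- apply: derivable_within_continuous => t; rewrite in_itv /= => tab.
  exact: (@ex_derive _ _ _ _ _ _ _ (fD t tab)).
have ba0 : 0 <= b - a by rewrite subr_ge0.
by have := ler_wpM2r ba0 (dm c cab); move: E => /= <-; lra.
Qed.

Lemma lipschitz_along (R : realType) n (x dx : R -> 'rV[R]_n) (a b c : R) :
  a <= b -> 0 <= c -> (forall t : R, a <= t <= b -> is_derive t 1 x (dx t)) ->
  (forall t, `|dx t| <= c) -> `|x b - x a| <= c * (b - a).
Proof.
move=> ab c0 xD dc.
have := @MVT_rV_le R n x dx a b 0 c ab c0.
rewrite scaler0 subr0; apply.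
- by move=> t; rewrite in_itv /= => /andP[/ltW ta /ltW tb]; apply: xD; rewrite ta.
- apply: continuous_in_subspaceT => t; rewrite inE /= in_itv /= => tab.
  exact: is_derive_cvg (xD t tab).
- by move=> t _; rewrite subr0.
Qed.

Lemma near_grad_ge (R : realType) n (f : 'rV[R]_n -> R) (p : 'rV[R]_n) :
  C2 f -> grad f p != 0 -> exists2 r : R, 0 < r &
    forall z, `|z - p| < r -> eucl (grad f p) / 2 <= eucl (grad f z).
Proof.
move=> fC fp; have c0 := eucl_gt0 fp.
have c2 : 0 < eucl (grad f p) / 2 by rewrite divr_gt0.
have := loclip_continuous (loclip_eucl_grad fC fp).
move=> /(@cvgrPdistC_le _ _ _ (nbhs p))/(_ _ c2)/nbhs_ballP[r /= r0 rP].
exists r => // z zr; have /rP : ball p r z by rewrite -ball_normE /ball_ /= distrC.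
by move=> /ler_normlP[H _]; lra.
Qed.

Lemma bounded_rV_compact (R : realType) n (r : R) :
  compact [set v : 'rV[R]_n | `|v| <= r].
Proof.
have [r0|r0] := leP 0 r; last first.
  rewrite (_ : [set v | _] = set0); first exact: compact0.
  by rewrite -subset0 => v /= /(le_trans (normr_ge0 _)); rewrite leNgt r0.
rewrite (_ : [set v | _] =
    [set v : 'rV[R]_n | forall i, (`[- r, r]%classic) (v ord0 i)]).
  by apply: (@rV_compact _ n (fun=> `[- r, r]%classic)) => i; exact: segment_compact.
apply/seteqP; split => v /= H.
  by move=> i; rewrite in_itv /= -ler_norml; apply: le_trans H; exact: ler_coord_norm.
by apply: rV_norm_le => // i; rewrite ler_norml; have := H i; rewrite in_itv.
Qed.

Lemma coercive_trapped (R : realType) n (f : 'rV[R]_n -> R) (M : R) :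
  coercive f -> exists r : R, forall x, f x <= M -> `|x| <= r.
Proof.
move=> /(_ M)[r rP]; exists r => x fx.
rewrite leNgt; apply/negP => rx.
by have := rP x (lt_le_trans rx (ler_norm_eucl x)); rewrite ltNge fx.
Qed.

(* Near a limit point where the gradient does not vanish, [f] drops by a fixed
   amount after each visit, below its limit value [f p]. *)
Lemma limit_point_critical (R : realType) n (f g : 'rV[R]_n -> R) (z : R)
    (x : R -> 'rV[R]_n) (p : 'rV[R]_n) :
  C2 f -> 0 <= z < 1 ->
  (forall t, 0 < t -> domE f g (x t)) ->
  (forall t : R, 0 < t -> is_derive t 1 x (sfield f g z (x t))) ->
  cluster (x @ left_end +oo%E) p -> grad f p = 0.
Proof.
move=> fC /andP[z0 z1] xE xD clp; apply/eqP; apply/negPn/negP => fp.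
have fC1 := C2_C1 fC.
have c0 := eucl_gt0 fp; set c := eucl (grad f p) in c0.
have [r r0 rP] := near_grad_ge fC fp.
have fp_cont : {for p, continuous f} by exact: loclip_continuous (C1_loclip p fC1).
have visit (e t0 : R) : 0 < e -> exists t, [/\ t0 < t, 0 < t & `|x t - p| < e].
  move=> e0.
  have xA : (x @ left_end +oo%E) (x @` [set t | t0 < t /\ 0 < t]).
    exists (Num.max t0 0); first exact: ltry.
    by move=> t /= [+ _]; rewrite gt_max => /andP[a b]; exists t.
  have [y [[t /= [a b] <-]]] := clp _ _ xA (nbhsx_ballx p _ e0).
  by rewrite -ball_normE /ball_ /= distrC => xt; exists t.
have drop a b m : 0 < a -> a <= b -> 0 <= m ->
    (forall t, a <= t <= b -> m <= eucl (grad f (x t))) ->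
    f (x b) <= f (x a) - (1 - z) * m * (b - a).
  move=> a0 ab m0 mP.
  apply: (@drop_along R n f x (fun t => sfield f g z (x t))) => //.
    by move=> t /andP[ta _]; apply: xD; exact: lt_le_trans ta.
  move=> t /[dup] /mP mt /andP[ta _].
  have [ft gt] := xE t (lt_le_trans a0 ta).
  apply: le_trans (dot_sfield_le z0 ft gt) _.
  by rewrite mulNr lerN2 ler_pM2l// subr_gt0.
have mono a b : 0 < a -> a <= b -> f (x b) <= f (x a).
  move=> a0 ab; have := drop a b 0 a0 ab (lexx _).
  by rewrite mulr0 mul0r subr0; apply=> t _; exact: sqrtr_ge0.
have near_f (e : R) : 0 < e -> exists2 d : R, 0 < d &
    forall y, `|y - p| < d -> `|f y - f p| <= e.
  move=> e0; have /(@cvgrPdistC_le _ _ _ (nbhs p))/(_ _ e0) := fp_cont.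
  move=> /nbhs_ballP[d /= d0 dP]; exists d => // y yd; apply: dP.
  by rewrite -ball_normE /ball_ /= distrC.
(* A value below [f p] would persist by monotonicity, while later visits near [p] bring [f] close to
   [f p]. *)
have lower s : 0 < s -> f p <= f (x s).
  move=> s0; rewrite leNgt; apply/negP => fs.
  have e0 : 0 < (f p - f (x s)) / 2 by rewrite divr_gt0// subr_gt0.
  have [d d0 dP] := near_f _ e0.
  have [t [st t0 /dP/ler_normlP[H _]]] := visit d s d0.
  by have := mono s t s0 (ltW st); lra.
(* From within [r / 2] of [p], speed at most 2 keeps the curve within [r] for time [r / 4]. There
   the gradient is at least [c / 2], so [f] drops by [k]: from at most [f p + k / 2] to below
   [f p]. *)
pose k := (1 - z) * (c / 2) * (r / 4).
have k0 : 0 < k by rewrite !mulr_gt0 ?divr_gt0 ?subr_gt0.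
have k2 : 0 < k / 2 by rewrite divr_gt0.
have [d d0 dP] := near_f _ k2.
have m0 : 0 < Num.min d (r / 2) by rewrite lt_min d0 divr_gt0.
have [t [_ t0]] := visit _ 0 m0; rewrite lt_min => /andP[/dP/ler_normlP[_ H] tr].
have r4 : 0 < r / 4 by rewrite divr_gt0.
have := drop t (t + r / 4) (c / 2) t0; rewrite lerDl (ltW r4).
have -> : t + r / 4 - t = r / 4 by ring.
have c2 : 0 <= c / 2 by rewrite divr_ge0// ltW.
rewrite -/k => /(_ isT c2) D.
have L : 0 < t + r / 4 by rewrite addr_gt0.
have := lower _ L; suff : f (x (t + r / 4)) <= f (x t) - k by lra.
apply: D => s /andP[ts sr]; apply: rP.
have zz : 0 <= z <= 1 by rewrite z0 ltW.
have xs : `|x s - x t| <= 2 * (s - t).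
  apply: (@lipschitz_along R n x (fun t => sfield f g z (x t))) => //.
    by move=> q /andP[tq _]; apply: xD; exact: lt_le_trans tq.
  by move=> q; exact: sfield_norm_le.
rewrite -(subrK (x t) (x s)) -addrA; apply: le_lt_trans (ler_normD _ _) _; lra.
Qed.

(** Glue to [x], at time [r], the local solution through [p] shifted by [r]. *)
Lemma extend_solution (R : realType) n (f g : 'rV[R]_n -> R) (z r : R)
    (x0 p : 'rV[R]_n) (x : R -> 'rV[R]_n) :
  C2 f -> C2 g -> (forall y, grad g y != 0) -> grad f p != 0 ->
  is_sol f g z x0 r%:E x -> x t @[t --> r^'-] --> p ->
  exists2 T' : \bar R, (r%:E < T')%E & exists y, is_sol f g z x0 T' y.
Proof.
move=> fC gC gn fp [r0 [xx0 [xr0 [xE xD]]]] xp.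
rewrite lte_fin in r0.
have sl := loclip_sfield z fC gC fp (gn p).
have [h h0 [Y [Y0 YD]]] := ex_local_solution sl.
have Yc t : `|t| < h -> {for t, continuous Y}.
  by move=> th; exact: is_derive_cvg (YD t th).
have Yc0 : {for 0, continuous Y} by apply: Yc; rewrite normr0.
have [q q0 qP] := near_grad_ge fC fp.
(* For times below [d] the local solution stays where [grad f] is nonzero, so the prolongation
   remains in [domE f g]. *)
have [d d0 dP] : exists2 d : R, 0 < d & forall t, `|t| < d -> `|Y t - p| < q.
  have q2 : 0 < q / 2 by rewrite divr_gt0.
  have /(@cvgrPdistC_le _ _ _ (nbhs (0 : R)))/(_ _ q2) := Yc0; rewrite Y0.
  move=> /nbhs_ballP[d /= d0 dP]; exists d => // t td.
  apply: le_lt_trans (dP _ _) _; last by lra.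
  by rewrite -ball_normE /ball_ /= sub0r normrN.
pose h' := Num.min h d.
have h'0 : 0 < h' by rewrite lt_min h0.
have h'P t : `|t| < h' -> `|t| < h /\ `|t| < d by rewrite lt_min => /andP.
pose y t := if t < r then x t else Y (t - r).
have yl t : t < r -> y t = x t by rewrite /y => ->.
have yr t : r <= t -> y t = Y (t - r) by rewrite /y ltNge => ->.
have yrr : y r = p by rewrite yr// subrr.
have nyl t : t < r -> \forall s \near t, x s = y s.
  move=> tr; near=> s; rewrite yl//; near: s; exact: lt_nbhsl.
have yD1 t : 0 < t < r -> is_derive t 1 y (sfield f g z (y t)).
  move=> /andP[t0 tr]; rewrite yl//.
  by apply: near_eq_is_derive (nyl t tr) _; apply: xD; rewrite ?lte_fin.
have YrD (t : R) : `|t - r| < h ->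
    is_derive t 1 (fun s => Y (s - r)) (sfield f g z (Y (t - r))).
  move=> th; have [Y1 Y2] := YD _ th.
  have E : (fun k : R => k^-1 *: (Y (k *: (1 : R) + (t - r)) - Y (t - r))) =
      (fun k : R => k^-1 *: (Y (k *: (1 : R) + t - r) - Y (t - r))).
    by apply/funext => k; rewrite addrA.
  split; first by move: Y1; rewrite /derivable /= E.
  by rewrite -Y2 /derive /= E.
have yD2 t : r < t < r + h -> is_derive t 1 y (sfield f g z (y t)).
  move=> /andP[rt th]; rewrite (yr t (ltW rt)).
  apply: (@near_eq_is_derive _ _ _ (fun s => Y (s - r))).
    near=> s; rewrite yr//; apply: ltW; near: s; exact: lt_nbhsr.
  by apply: YrD; rewrite ger0_norm; lra.
have yc : {for r, continuous y}.
  apply/(@cvgrPdistC_le _ _ _ (nbhs r)) => e e0; rewrite yrr.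
  have /cvgrPdistC_le/(_ e e0)[a /= a0 aP] := xp.
  have /(@cvgrPdistC_le _ _ _ (nbhs (0 : R)))/(_ e e0) := Yc0; rewrite Y0.
  move=> /nbhs_ballP[b /= b0 bP].
  apply/nbhs_ballP; exists (Num.min a b) => /=; first by rewrite lt_min a0.
  move=> t; rewrite -ball_normE /ball_ /= lt_min => /andP[ta tb].
  have [tr|rt] := ltP t r.
    by rewrite yl//; apply: aP.
  by rewrite yr//; apply: bP; rewrite -ball_normE /ball_ /= sub0r normrN distrC.
(* On both sides of [r] the derivative is the field along [y], which is continuous at [r], so it
   tends to the field at [p]. *)
have yDr : is_derive r 1 y (sfield f g z p).
  have rh : 0 < Num.min r h by rewrite lt_min r0.
  apply: (@is_derive_limit R n y (fun t => sfield f g z (y t)) r _ _ rh) => //.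
    move=> t; rewrite normr_gt0 subr_eq0 lt_min => /andP[tr /andP[t1 t2]].
    have [tlr|rt|E] := ltgtP t r; last by rewrite E eqxx in tr.
      apply: yD1; rewrite tlr andbT; move/ltr_normlP : t1 => [? ?]; lra.
    apply: yD2; rewrite rt /=; move/ltr_normlP : t2 => [? ?]; lra.
  move=> e e0; have sc := loclip_continuous sl.
  have syc : {for r, continuous (sfield f g z \o y)}.
    by apply: continuous_comp; [exact: yc|rewrite yrr].
  have /(@cvgrPdistC_le _ _ _ (nbhs r))/(_ e e0) := syc; rewrite /= yrr.
  move=> /nbhs_ballP[b /= b0 bP]; exists b => // t /andP[_ tb]; apply: bP.
  by rewrite -ball_normE /ball_ /= distrC.
exists (r + h')%:E; first by rewrite lte_fin ltrDl.
exists y; split; first by rewrite lte_fin addr_gt0.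
split; first by rewrite yl.
split.
  apply: cvg_trans xr0; apply: near_eq_cvg; near=> t.
  by rewrite yl//; near: t; exact: nbhs_right_lt.
split=> t t0; rewrite lte_fin => th.
  have [tr|rt] := ltP t r; first by rewrite yl//; apply: xE; rewrite ?lte_fin.
  rewrite yr//; split; last exact: gn.
  have /h'P[_ td] : `|t - r| < h' by rewrite ger0_norm; lra.
  rewrite -eucl_eq0 gt_eqF//; apply: lt_le_trans (qP _ (dP _ td)).
  by rewrite divr_gt0// eucl_gt0.
have [tr|rt|->] := ltgtP t r.
- by apply: yD1; rewrite t0.
- apply: yD2; rewrite rt /=; apply: lt_le_trans th _.
  by rewrite lerD2l ge_min lexx.
- by rewrite yrr.
Unshelve. all: by end_near. Qed.

(** The singleton is both open and closed relative to [L]: it is the trace of a ball and of a closed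
    set. *)
Lemma connected_isolated_point (R : realType) n (L : set 'rV[R]_n) (p : 'rV[R]_n)
    (r : R) : 0 < r -> connected L -> L p ->
  (forall q, L q -> `|q - p| < r -> q = p) -> L = [set p].
Proof.
move=> r0 cL Lp Lr; apply/esym/cL; first by exists p.
  exists (ball p r); first exact: ball_open.
  apply/seteqP; split => [_ ->|q [Lq]]; first by split => //; exact: ballxx.
  by rewrite -ball_normE /ball_ /= distrC; exact: Lr.
exists [set p]; last by apply/esym/setIidPr => _ ->.
by apply: compact_closed; [exact: norm_hausdorff|exact: compact_set1].
Qed.

(** * Convergence of maximal trajectories *)

Unset Implicit Arguments.

Theorem theorem5p7 (R : realType) (n : nat) (f g : 'rV[R]_n -> R)
  (zeta : R) (x0 : 'rV[R]_n) (T : \bar R) (x : R -> 'rV[R]_n) :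
  C2 f -> C2 g -> coercive f ->
  (forall y, grad g y != 0) ->
  0 <= zeta < 1 ->
  g x0 <= 0 ->
  is_max_traj f g zeta x0 T x ->
  (* x(t) converges to a (nonempty) connected set of critical points of f,
     namely its limit set as t -> T^- *)
  (limit_set T x !=set0 /\
   connected (limit_set T x) /\
   limit_set T x `<=` critical f /\
   (forall e : R, 0 < e -> exists t0 : R, (t0%:E < T)%E /\
      forall t : R, t0 < t -> (t%:E < T)%E ->
        exists2 p, limit_set T x p & eucl (x t - p) < e)) /\
  (* in particular, if the critical points are isolated, x(t) -> x_c *)
  (isolated_critical f ->
   exists xc, critical f xc /\
     forall e : R, 0 < e -> exists t0 : R, (t0%:E < T)%E /\
       forall t : R, t0 < t -> (t%:E < T)%E -> eucl (x t - xc) < e).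
Proof.
move=> fC gC cf gn /andP[z0 z1] _ [sol maxT].
have [T0 [xx0 [_ [xE xD]]]] := sol.
have FT := left_end_proper T0.
have fC1 := C2_C1 fC.
have zz : 0 <= zeta <= 1 by rewrite z0 ltW.
pose s := sfield f g zeta.
(* Times start at [a > 0] because [is_sol] provides derivatives only at positive times. *)
have lip a b : 0 < a -> a <= b -> (b%:E < T)%E -> `|x b - x a| <= 2 * (b - a).
  move=> a0 ab bT.
  apply: (@lipschitz_along R n x (fun t => s (x t))) => //.
    move=> t /andP[ta tb]; apply: xD; first exact: lt_le_trans ta.
    by apply: le_lt_trans bT; rewrite lee_fin.
  by move=> t; exact: sfield_norm_le.
have mono a b : 0 < a -> a <= b -> (b%:E < T)%E -> f (x b) <= f (x a).
  move=> a0 ab bT.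
  have tT t : a <= t <= b -> 0 < t /\ (t%:E < T)%E.
    move=> /andP[ta tb]; split; first exact: lt_le_trans ta.
    by apply: le_lt_trans bT; rewrite lee_fin.
  have := @drop_along R n f x (fun t => s (x t)) a b 0 fC1 ab.
  rewrite mul0r subr0; apply=> t /tT[t0 tT']; first exact: xD.
  have [ft gt] := xE t (ltW t0) tT'.
  apply: le_trans (dot_sfield_le z0 ft gt) _.
  by rewrite mulNr lerN2 mulr_ge0 ?sqrtr_ge0// subr_ge0 ltW.
have [t1 t10 t1T] := lt_between T0.
(* From time [t1] on, [x] stays in a sublevel set of [f], which coercivity bounds. *)
have [r rP] := coercive_trapped (f (x t1)) cf.
pose K := [set v : 'rV[R]_n | `|v| <= r].
have cK : compact K by exact: bounded_rV_compact.
have FK : (x @ left_end T) K.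
  exists t1 => // t /= [t1t tT]; apply: rP; apply: mono => //; exact: ltW.
have base A : (x @ left_end T) A ->
    exists B, [/\ B `<=` A, (x @ left_end T) B & connected B].
  move=> [t0 /= t0T tA]; pose t2 := Num.max t0 t1.
  exists (x @` [set t | t2 < t /\ (t%:E < T)%E]); split.
  - move=> _ [t /= [t2t tT] <-]; apply: tA; split => //.
    by apply: le_lt_trans t2t; rewrite le_max lexx.
  - exists t2; first by rewrite /= /t2; case: (leP t0 t1).
    by move=> t /= tt; exists t.
  - apply: connected_continuous_connected.
      apply/connected_intervalP => a b /= [a1 a2] [b1 b2] c /andP[ac cb]; split.
        exact: lt_le_trans ac.
      by apply: le_lt_trans b2; rewrite lee_fin.
    apply: continuous_in_subspaceT => t; rewrite inE /= => -[t2t tT].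
    apply: is_derive_cvg (xD t _ tT); apply: lt_trans t2t.
    by rewrite lt_max t10 orbT.
have cL : connected (cluster (x @ left_end T)).
  by apply: (cluster_connected (K := K)) => //; exact: norm_hausdorff.
have [p [_ clp]] := cK _ _ FK.
have crit q : cluster (x @ left_end T) q -> grad f q = 0.
  (* A finite end contradicts maximality through [extend_solution]; an infinite one is covered by
     [limit_point_critical]. *)
  case: T T0 sol maxT xE xD FT lip mono t1T FK base cL clp
    => [T| |] // T0 sol maxT xE xD FT lip mono t1T FK base cL clp clq.
    apply/eqP/negPn/negP => fq.
    have xq : x t @[t --> T^'-] --> q.
      (* Choose a time [a > T - e / 4] with [x a] within [e / 4] of [q]; the Lipschitz bound adds
         less than [2 * (e / 4)] up to [T]. *)
      apply/cvgrPdistC_le => e e0.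
      have e2 : 0 < e / 4 by rewrite divr_gt0.
      have xA : (x @ left_end T%:E)
          (x @` [set t | Num.max t1 (T - e / 4) < t /\ (t%:E < T%:E)%E]).
        exists (Num.max t1 (T - e / 4)); last by move=> t /= tt; exists t.
        rewrite /= lte_fin gt_max; rewrite lte_fin in t1T; rewrite t1T /=; lra.
      have [_ [[a /= [ma aT] <-]]] := clq _ _ xA (nbhsx_ballx q _ e2).
      rewrite -ball_normE /ball_ /= distrC => xa.
      move: ma; rewrite gt_max => /andP[ta ea].
      rewrite lte_fin in aT.
      near=> t.
      have at_ : a <= t by apply: ltW; near: t; exact: nbhs_left_gt.
      have tT : t < T by near: t; exact: nbhs_left_lt.
      have := lip a t (lt_trans t10 ta) at_; rewrite lte_fin => /(_ tT) H.
      rewrite -(subrK (x a) (x t)) -addrA; apply: le_trans (ler_normD _ _) _; lra.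
    have [T' TT' [y yP]] := extend_solution fC gC gn fq sol xq.
    exact: maxT TT' yP.
  apply: (@limit_point_critical R n f g zeta x) clq => //; first by rewrite z0.
    by move=> t t0; apply: xE; [exact: ltW|exact: ltry].
  by move=> t t0; apply: xD => //; exact: ltry.
have attract (e : R) : 0 < e -> exists t0 : R, (t0%:E < T)%E /\
    forall t : R, t0 < t -> (t%:E < T)%E ->
      exists2 p, limit_set T x p & eucl (x t - p) < e.
  move=> e0; rewrite limit_setE.
  have e1 : 0 < e / n.+1%:R by rewrite divr_gt0.
  (* Sup-norm radius [e / n.+1] ensures Euclidean distance below [e]. *)
  pose U := \bigcup_(q in cluster (x @ left_end T)) ball q (e / n.+1%:R).
  have [||t0 t0T tU] := cluster_attracts _ cK FK (_ : open U).
  - by apply: bigcup_open => q _; exact: ball_open.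
  - by move=> q clq; exists q => //; exact: ballxx.
  exists t0; split => // t t0t tT; have [q clq] := tU t (conj t0t tT).
  rewrite -ball_normE /ball_ /= distrC => /eucl_lt xq.
  by exists q.
split; first split; first by exists p; rewrite limit_setE.
  by split; [rewrite limit_setE|split => // q; rewrite limit_setE; exact: crit].
move=> iso; exists p; split; first exact: crit.
have [d [d0 dP]] := iso p (crit p clp).
(* All limit points are critical, so isolation of [p] among critical points isolates it in the
   connected limit set. *)
have Lp : limit_set T x = [set p].
  have d1 : 0 < d / n.+1%:R by rewrite divr_gt0.
  rewrite limit_setE; apply: (connected_isolated_point d1 cL clp) => q clq /eucl_lt qp.
  by apply: dP; first exact: crit.
move=> e /attract[t0 [t0T tL]]; exists t0; split => // t t0t tT.
by have [q] := tL t t0t tT; rewrite Lp => ->.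
Unshelve. all: by end_near. Qed.
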